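(* Let $\mathfrak{g}, \mathfrak{h}$ be two Leibniz algebras, let $\mathfrak{h}$ be a Leibniz $\mathfrak{g}$-representation, let $T: \mathfrak{h} \rightarrow \mathfrak{g}$ be a $\lambda$-weighted relative Rota-Baxter operator, and let $T_t^N = \sum_{i=0}^N t^i T_i$ be an order $N$ deformation of $T$. Then the obstruction cochain $$Ob_{T_t^N} = - \frac{1}{2} \sum_{i+j = N+1,\ i, j \geq 1} \llbracket T_i, T_j \rrbracket \in \mathrm{Hom}(\mathfrak{h}^{\otimes 2},\mathfrak{g})$$ is a $2$-cocycle in the cohomology complex of $T$, i.e. $\delta_\mathrm{Leib} (Ob_{T^N_t}) = 0$ (equivalently, $d_T (Ob_{T^N_t}) = 0$).
   Context: All vector spaces and (multi)linear maps are over a field $\mathbf{k}$ of characteristic $0$, and $\lambda \in \mathbf{k}$ is a fixed scalar. A (left) Leibniz algebra is a vector space $\mathfrak{g}$ with a bilinear bracket $[~,~]_\mathfrak{g}$ satisfying $[x,[y,z]_\mathfrak{g}]_\mathfrak{g} = [[x,y]_\mathfrak{g},z]_\mathfrak{g} + [y,[x,z]_\mathfrak{g}]_\mathfrak{g}$ for all $x,y,z$. A representation of $\mathfrak{g}$ is a vector space $V$ with bilinear maps $\rho^L : \mathfrak{g}\otimes V \to V$, $\rho^R : V \otimes \mathfrak{g} \to V$ such that for $x,y\in\mathfrak{g}$, $v \in V$: $\rho^L(x,\rho^L(y,v)) = \rho^L([x,y]_\mathfrak{g},v) + \rho^L(y,\rho^L(x,v))$; $\rho^L(x,\rho^R(v,y))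 = \rho^R(\rho^L(x,v),y) + \rho^R(v,[x,y]_\mathfrak{g})$; $\rho^R(v,[x,y]_\mathfrak{g}) = \rho^R(\rho^R(v,x),y) + \rho^L(x,\rho^R(v,y))$. A Leibniz algebra $\mathfrak{h}$ is a Leibniz $\mathfrak{g}$-representation if it has maps $\rho^L,\rho^R$ making it a representation of $\mathfrak{g}$ and, for $u,v\in\mathfrak{h}$, $x\in\mathfrak{g}$: $[u,\rho^R(v,x)]_\mathfrak{h} = \rho^R([u,v]_\mathfrak{h},x) + [v,\rho^R(u,x)]_\mathfrak{h}$; $[u,\rho^L(x,v)]_\mathfrak{h} = [\rho^R(u,x),v]_\mathfrak{h} + \rho^L(x,[u,v]_\mathfrak{h})$; $\rho^L(x,[u,v]_\mathfrak{h}) = [\rho^L(x,u),v]_\mathfrak{h} + [u,\rho^L(x,v)]_\mathfrak{h}$. A linear map $T:\mathfrak{h}\to\mathfrak{g}$ is a $\lambda$-weighted relative Rota-Baxter operator if $[Tu,Tv]_\mathfrak{g} = T(\rho^L(Tu,v)+\rho^R(u,Tv)+\lambda[u,v]_\mathfrak{h})$ for all $u,v\in\mathfrak{h}$. Cohomology complex of $T$: let $\mathfrak{h}_T$ be the Leibniz algebra $\mathfrak{h}$ with bracket $[u,v]_T = \rho^L(Tu,v)+\rho^R(u,Tv)+\lambda[u,v]_\mathfrak{h}$; it has a representation on $\mathfrak{g}$ given by $\varrho^L(u,x)=[Tu,x]_\mathfrak{g}-T(\rho^R(u,x))$, $\varrho^R(x,u)=[x,Tu]_\mathfrak{g}-T(\rho^L(x,u))$.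 The cochain groups are $\mathrm{Hom}(\mathfrak{h}^{\otimes n},\mathfrak{g})$, $n\ge 0$, with differential $$(\delta_{\mathrm{Leib}}f)(u_1,\ldots,u_{n+1}) = \sum_{i=1}^n(-1)^{i+1}\varrho^L(u_i,f(u_1,\ldots,\widehat{u_i},\ldots,u_{n+1})) + (-1)^{n+1}\varrho^R(f(u_1,\ldots,u_n),u_{n+1}) + \sum_{1\le i<j\le n+1}(-1)^i f(u_1,\ldots,\widehat{u_i},\ldots,u_{j-1},[u_i,u_j]_T,u_{j+1},\ldots,u_{n+1}).$$ Balavoine's bracket: for a vector space $V$, on $\oplus_{n\ge 0}\mathrm{Hom}(V^{\otimes n+1},V)$ (with $\mathrm{Hom}(V^{\otimes n+1},V)$ in degree $n$) one has the graded Lie bracket $$[f,g]_B = \sum_{i=1}^{m+1}(-1)^{(i-1)n} f\circ_i g - (-1)^{mn}\sum_{i=1}^{n+1}(-1)^{(i-1)m} g\circ_i f,$$ $$(f\circ_i g)(x_1,\ldots,x_{m+n+1}) = \sum_{\sigma\in Sh(i-1,n)}(-1)^\sigma f\big(x_{\sigma(1)},\ldots,x_{\sigma(i-1)}, g(x_{\sigma(i)},\ldots,x_{\sigma(i+n-1)},x_{i+n}),x_{i+n+1},\ldots,x_{m+n+1}\big)$$ for $f\in\mathrm{Hom}(V^{\otimes m+1},V)$, $g\in\mathrm{Hom}(V^{\otimes n+1},V)$, with $Sh(p,q)$ the $(p,q)$-shuffles. Bracket $\llbracket~,~\rrbracket$ and $d_T$: take $V=\mathfrak{g}\oplus\mathfrak{h}$,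 $\theta((x,u),(y,v)) = ([x,y]_\mathfrak{g},\rho^L(x,v)+\rho^R(u,y))$, and regard $\mathrm{Hom}(\mathfrak{h}^{\otimes n},\mathfrak{g})\subset\mathrm{Hom}(V^{\otimes n},V)$. For $P\in\mathrm{Hom}(\mathfrak{h}^{\otimes m},\mathfrak{g})$, $Q\in\mathrm{Hom}(\mathfrak{h}^{\otimes n},\mathfrak{g})$, $m,n\ge1$, set $\llbracket P,Q\rrbracket = (-1)^m[[\theta,P]_B,Q]_B$. For $m=n=1$ this reads $\llbracket P,Q\rrbracket(u,v) = P(\rho^L(Qu,v)+\rho^R(u,Qv)) + Q(\rho^L(Pu,v)+\rho^R(u,Pv)) - [Pu,Qv]_\mathfrak{g}-[Qu,Pv]_\mathfrak{g}$. Further, $d_T = d+\llbracket T,-\rrbracket$, where for $P\in\mathrm{Hom}(\mathfrak{h}^{\otimes n},\mathfrak{g})$ $$(dP)(u_1,\ldots,u_{n+1}) = (-1)^n\sum_{1\le i<j\le n+1}(-1)^i P(u_1,\ldots,\widehat{u_i},\ldots,u_{j-1},\lambda[u_i,u_j]_\mathfrak{h},u_{j+1},\ldots,u_{n+1}).$$ Finite order deformations: fix $N\in\mathbb{N}$. The Leibniz structures and actions extend $\mathbf{k}[[t]]/(t^{N+1})$-bilinearly to $\mathfrak{g}[[t]]/(t^{N+1})$ and $\mathfrak{h}[[t]]/(t^{N+1})$. An order $N$ deformation of $T$ is $T_t^N=\sum_{i=0}^Nt^iT_i\in\mathrm{Hom}(\mathfrak{h},\mathfrak{g})[[t]]/(t^{N+1})$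 with $T_0=T$ such that the $\mathbf{k}[[t]]/(t^{N+1})$-linear map $T_t^N:\mathfrak{h}[[t]]/(t^{N+1})\to\mathfrak{g}[[t]]/(t^{N+1})$ is a $\lambda$-weighted relative Rota-Baxter operator. *)

(* Defs.v *)
From HB Require Import structures.
From mathcomp Require Import all_boot all_order all_algebra all_fingroup.

Set Implicit Arguments.
Unset Strict Implicit.
Unset Printing Implicit Defensive.

Import GRing.Theory.
Local Open Scope ring_scope.

(* Brackets and actions are plain functions in these predicates, because they
   are also used for the truncated power series extensions below. *)

Definition leibniz_bracket (g : zmodType) (br : g -> g -> g) : Prop :=
  forall x y z, br x (br y z) = br (br x y) z + br y (br x z).

Definition representation (g V : zmodType) (br : g -> g -> g)
    (rhoL : g -> V -> V) (rhoR : V -> g -> V) : Prop :=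
  [/\ forall x y v, rhoL x (rhoL y v) = rhoL (br x y) v + rhoL y (rhoL x v),
      forall x v y, rhoL x (rhoR v y) = rhoR (rhoL x v) y + rhoR v (br x y)
    & forall v x y, rhoR v (br x y) = rhoR (rhoR v x) y + rhoL x (rhoR v y)].

Definition leibniz_representation (g h : zmodType)
    (brg : g -> g -> g) (brh : h -> h -> h)
    (rhoL : g -> h -> h) (rhoR : h -> g -> h) : Prop :=
  [/\ representation brg rhoL rhoR,
      forall u v x, brh u (rhoR v x) = rhoR (brh u v) x + brh v (rhoR u x),
      forall u x v, brh u (rhoL x v) = brh (rhoR u x) v + rhoL x (brh u v)
    & forall x u v, rhoL x (brh u v) = brh (rhoL x u) v + brh u (rhoL x v)].

Definition induced_bracket (k : pzRingType) (lam : k) (g : zmodType)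
    (h : lmodType k) (brh : h -> h -> h)
    (rhoL : g -> h -> h) (rhoR : h -> g -> h) (T : h -> g) (u v : h) : h :=
  rhoL (T u) v + rhoR u (T v) + lam *: brh u v.

Definition relative_rota_baxter (k : pzRingType) (lam : k) (g : zmodType)
    (h : lmodType k) (brg : g -> g -> g) (brh : h -> h -> h)
    (rhoL : g -> h -> h) (rhoR : h -> g -> h) (T : h -> g) : Prop :=
  forall u v, brg (T u) (T v) = T (induced_bracket lam brh rhoL rhoR T u v).

(* Elements of Hom(U^{(x) n}, W) are functions of n arguments satisfying
   [multilinear]; the operations below are defined on all functions.  All
   indices are 0-based, which shifts the signs of the usual 1-based formulas. *)

Definition cochain (n : nat) (U W : Type) := {ffun 'I_n -> U} -> W.

Definition update (n : nat) (U : Type) (x : {ffun 'I_n -> U}) (i : 'I_n)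
    (u : U) : {ffun 'I_n -> U} :=
  [ffun j => if j == i then u else x j].

Definition multilinear (k : pzRingType) (n : nat) (U W : lmodType k)
    (f : cochain n U W) : Prop :=
  forall (i : 'I_n) (x : {ffun 'I_n -> U}) (a : k) (u v : U),
    f (update x i (a *: u + v)) = a *: f (update x i u) + f (update x i v).

Definition cochain1 (U W : Type) (T : U -> W) : cochain 1 U W :=
  fun u => T (u ord0).

Definition omit (n : nat) (U : Type) (i : 'I_n.+1) (u : {ffun 'I_n.+1 -> U}) :
    {ffun 'I_n -> U} :=
  [ffun a => u (lift i a)].

(* u with u_i omitted and u_j replaced by [u_i, u_j]. *)
Definition contract (n : nat) (U : Type) (br : U -> U -> U) (i j : 'I_n.+1)
    (u : {ffun 'I_n.+1 -> U}) : {ffun 'I_n -> U} :=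
  omit i [ffun a => if a == j then br (u i) (u j) else u a].

Section LeibnizCohomology.
Variables (k : fieldType) (lam : k) (g h : lmodType k).
Variables (brg : g -> g -> g) (brh : h -> h -> h).
Variables (rhoL : g -> h -> h) (rhoR : h -> g -> h) (T : h -> g).

Definition varrhoL (u : h) (x : g) : g := brg (T u) x - T (rhoR u x).
Definition varrhoR (x : g) (u : h) : g := brg x (T u) - T (rhoL x u).

Definition delta_Leib (n : nat) (f : cochain n h g) : cochain n.+1 h g :=
  fun u =>
    \sum_(i < n.+1 | (i < n)%N) (-1) ^+ i *: varrhoL (u i) (f (omit i u))
    + (-1) ^+ n.+1 *: varrhoR (f (omit ord_max u)) (u ord_max)
    + \sum_(i < n.+1) \sum_(j < n.+1 | (i < j)%N)
        (-1) ^+ i.+1 *: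
          f (contract (induced_bracket lam brh rhoL rhoR T) i j u).

End LeibnizCohomology.

Section Balavoine.
Variables (k : fieldType) (V : lmodType k).

(* A permutation of {0, .., n-1}, as a function on nat (the identity beyond). *)
Definition permn (n : nat) (s : 'S_n) (a : nat) : nat :=
  if insub a is Some a' then s a' : nat else a.

Definition shuffle (p q : nat) : {set 'S_(p + q)} :=
  [set s : 'S_(p + q) |
    [forall a : 'I_p, forall b : 'I_p,
       (a < b)%N ==> (s (lshift q a) < s (lshift q b))%N] &&
    [forall a : 'I_q, forall b : 'I_q,
       (a < b)%N ==> (s (rshift p a) < s (rshift p b))%N]].

(* [circ i f g] inserts g in the slot i of f, 0 <= i <= m; every [inord]
   below is applied to a value at most m + n. *)
Definition circ (m n i : nat) (f : cochain m.+1 V V) (g : cochain n.+1 V V) :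
    cochain (m + n).+1 V V :=
  fun x =>
    \sum_(s in shuffle i n)
      (-1) ^+ (s : bool) *:
      f [ffun a : 'I_m.+1 =>
           if (a < i)%N then x (inord (permn s a))
           else if a == i :> nat then
             g [ffun b : 'I_n.+1 =>
                  if (b < n)%N then x (inord (permn s (i + b)))
                  else x (inord (i + n))]
           else x (inord (a + n))].

Definition balavoine (m n : nat) (f : cochain m.+1 V V)
    (g : cochain n.+1 V V) : cochain (m + n).+1 V V :=
  fun x =>
    \sum_(i < m.+1) (-1) ^+ (i * n) *: circ i f g x
    - (-1) ^+ (m * n) *:
      \sum_(i < n.+1) (-1) ^+ (i * m) *:
        circ i g f [ffun a => x (cast_ord (congr1 S (addnC n m)) a)].

End Balavoine.

Section DerivedBracket.
Variables (k : fieldType) (lam : k) (g h : lmodType k).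
Variables (brg : g -> g -> g) (brh : h -> h -> h).
Variables (rhoL : g -> h -> h) (rhoR : h -> g -> h) (T : h -> g).

Local Notation V := (g * h)%type.

Definition theta : cochain 2 V V := fun x =>
  (brg (x ord0).1 (x ord_max).1,
   rhoL (x ord0).1 (x ord_max).2 + rhoR (x ord0).2 (x ord_max).1).

(* The inclusion of Hom(h^{(x) n}, g) in Hom(V^{(x) n}, V), and its left
   inverse. *)
Definition embed (n : nat) (P : cochain n h g) : cochain n V V :=
  fun x => (P [ffun a => (x a).2], 0).

Definition unembed (n : nat) (F : cochain n V V) : cochain n h g :=
  fun u => (F [ffun a => (0, u a)]).1.

(* For P of arity m + 1 and Q of arity n + 1; the iterated Balavoine bracket
   lies in the image of [embed], and [unembed] reads it as a map on h. *)
Definition derived_bracket (m n : nat) (P : cochain m.+1 h g)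
    (Q : cochain n.+1 h g) : cochain (m + n).+2 h g :=
  fun u => (-1) ^+ m.+1 *:
    unembed (balavoine (balavoine theta (embed P)) (embed Q)) u.

Definition d_weight (n : nat) (P : cochain n h g) : cochain n.+1 h g :=
  fun u => (-1) ^+ n *:
    \sum_(i < n.+1) \sum_(j < n.+1 | (i < j)%N)
      (-1) ^+ i.+1 *: P (contract (fun v w => lam *: brh v w) i j u).

Definition d_T (n : nat) (P : cochain n.+1 h g) : cochain n.+2 h g :=
  fun u => d_weight P u + derived_bracket (cochain1 T) P u.

End DerivedBracket.

(* W[[t]]/(t^{N+1}) is {ffun 'I_N.+1 -> W}, x i being the coefficient of t^i. *)
Section Truncated.
Variables (N : nat) (X Y W : zmodType).

Definition trunc_bilin (B : X -> Y -> W) (x : {ffun 'I_N.+1 -> X})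
    (y : {ffun 'I_N.+1 -> Y}) : {ffun 'I_N.+1 -> W} :=
  [ffun l : 'I_N.+1 => \sum_(i < N.+1) \sum_(j < N.+1 | (i + j == l)%N)
                         B (x i) (y j)].

Definition trunc_map (T_ : 'I_N.+1 -> Y -> W) (y : {ffun 'I_N.+1 -> Y}) :
    {ffun 'I_N.+1 -> W} :=
  [ffun l : 'I_N.+1 => \sum_(i < N.+1) \sum_(j < N.+1 | (i + j == l)%N)
                         T_ i (y j)].

End Truncated.

Section Deformation.
Variables (k : fieldType) (lam : k) (g h : lmodType k).
Variables (brg : g -> g -> g) (brh : h -> h -> h).
Variables (rhoL : g -> h -> h) (rhoR : h -> g -> h).
Variables (N : nat) (T_ : 'I_N.+1 -> h -> g).

Definition deformation (T : h -> g) : Prop :=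
  T_ ord0 =1 T /\
  relative_rota_baxter lam (trunc_bilin (N := N) brg) (trunc_bilin brh)
    (trunc_bilin rhoL) (trunc_bilin rhoR) (trunc_map T_).

Definition obstruction : cochain 2 h g := fun u =>
  - (2%:R^-1 : k) *:
  \sum_(i < N.+1) \sum_(j < N.+1 | [&& (i + j == N.+1)%N, (0 < i)%N & (0 < j)%N])
    derived_bracket brg rhoL rhoR (cochain1 (T_ i)) (cochain1 (T_ j)) u.

End Deformation.

(* Main.v *)
Require Import Defs.
From HB Require Import structures.
From mathcomp Require Import all_boot all_order all_algebra all_fingroup.

Set Implicit Arguments.
Unset Strict Implicit.
Unset Printing Implicit Defensive.

Import GRing.Theory.
Local Open Scope ring_scope.

(** Write {u, v}_P = rhoL (P u) v + rhoR u (P v) + lam [u, v] for a linear map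
    P : h -> g, and call E_P(u, v) = [P u, P v] - P {u, v}_P the curvature of P;
    P is a relative Rota-Baxter operator exactly when E_P = 0.  The theorem is
    the lowest-order part of a Bianchi identity: the formula of the differential
    delta_P annihilates E_P for every linear P ([delta2_curvature]).  The reason
    is that the defect of {_, _}_P in the Leibniz identity is made of E_P acting
    through rhoL and rhoR ([induced_bracket_defect]), so that what delta_P E_P
    leaves is the Leibniz identity of g.

    Evaluate the deformation at a scalar s, which gives an honest linear map
    P_s = T_0 + s T_1 + ... + s^N T_N.  The deformation equations say that the
    coefficients of 1, s, ..., s^N in the curvature of P_s vanish, and no term
    lam [u, v] enters beyond them, so E_(P_s) = s^(N+1) R_s with R_s polynomial
    in s ([curvature_pencil]).  The constant coefficient R_0 is the obstruction
    cochain, the factor 1/2 accounting for the symmetry of the derived bracket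
    ([obstructionE]).  By the Bianchi identity s^(N+1) delta_(P_s) R_s = 0, so
    the polynomial s |-> delta_(P_s) R_s vanishes at every s <> 0; the field is
    infinite, so it vanishes at 0 too ([polycurve_eq0]), where it is
    delta_T Ob.

    It remains to know what delta_Leib, d_T and the derived bracket are in low
    arity.  Expanding the shuffles gives delta_Leib f = d_T f for every bilinear
    f ([delta_Leib2], [derived_bracket12], [d_T2]). *)

(** * The Bianchi identity *)

Section Bianchi.
Variables (k : fieldType) (lam : k) (g h : lmodType k).
Variables (brg : {bilinear g -> g -> g}) (brh : {bilinear h -> h -> h}).
Variables (rhoL : {bilinear g -> h -> h}) (rhoR : {bilinear h -> g -> h}).
Hypotheses (leibniz_g : leibniz_bracket brg) (leibniz_h : leibniz_bracket brh).
Hypothesis rep_h : leibniz_representation brg brh rhoL rhoR.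

Definition curvature (P : h -> g) (u v : h) : g :=
  brg (P u) (P v) - P (induced_bracket lam brh rhoL rhoR P u v).

(** The formula of [delta_Leib] on 2-cochains.  The evaluations of a truncated
    deformation at scalars have nonzero curvature, so P is an arbitrary map and
    the formula need not square to zero. *)
Definition delta2 (P : h -> g) (F : h -> h -> g) (u v w : h) : g :=
  let br := induced_bracket lam brh rhoL rhoR P in
  varrhoL brg rhoR P u (F v w) - varrhoL brg rhoR P v (F u w)
  - varrhoR brg rhoL P (F u v) w
  - F (br u v) w - F v (br u w) + F u (br v w).

(** Adding [rhoR u (curvature P v w)] to {u, {v, w}} turns its term
    rhoR u (P {v, w}), to which no axiom applies, into rhoR u [P v, P w], and
    likewise on the other side.  Then each of the seven terms on the left splits
    in two by its own axiom: the six of a Leibniz representation and the Leibniz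
    identity of h. *)
Lemma induced_bracket_defect (P : {linear h -> g}) (u v w : h) :
  let br := induced_bracket lam brh rhoL rhoR P in
  br u (br v w) + rhoR u (curvature P v w) =
    (br (br u v) w + rhoL (curvature P u v) w)
    + (br v (br u w) + rhoR v (curvature P u w)).
Proof.
move=> br; case: rep_h => -[rLL rLR rRR] hR hLR hL.
have outer x y z : br x (br y z) + rhoR x (curvature P y z) =
    rhoL (P x) (br y z) + rhoR x (brg (P y) (P z)) + lam *: brh x (br y z).
  rewrite -[curvature P y z]/(_ - P (br y z)) linearBr.
  by rewrite {1}/br /induced_bracket addrAC -[X in X + _]addrA subrKC.
have inner : br (br u v) w + rhoL (curvature P u v) w =
    rhoL (brg (P u) (P v)) w + rhoR (br u v) (P w) + lam *: brh (br u v) w.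
  rewrite -[curvature P u v]/(_ - P (br u v)) linearBl.
  by rewrite [in LHS]addrC {1}/br /induced_bracket !addrA subrK.
rewrite !outer inner /br /induced_bracket.
rewrite !(linearDr, linearDl, linearZr, linearZl) /= !scalerDr.
rewrite (rLL (P u)) (rLR (P u) v) (hL (P u) v w) (rRR u (P v)).
rewrite (hLR u (P v)) (hR u v) (leibniz_h u v w) !scalerDr !addrA.
(* Each axiom has produced one term of {{u, v}, w} and one of {v, {u, w}}; the
   permutation lists the former, then the latter. *)
by rewrite [LHS](ACl (1*3*7*11*5*9*13*2*8*10*4*6*12*14)).
Qed.

(** Pairing each [varrhoL] or [varrhoR] term with the [curvature] term whose
    bracket contains the same P {_, _} cancels those brackets.  What remains is
    the Leibniz identity of g and P applied to [induced_bracket_defect]. *)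
Lemma delta2_curvature (P : {linear h -> g}) (u v w : h) :
  delta2 P (curvature P) u v w = 0.
Proof.
rewrite /delta2; set br := induced_bracket _ _ _ _ _.
have step x y z : varrhoL brg rhoR P x (curvature P y z)
      + curvature P x (br y z) =
    brg (P x) (brg (P y) (P z)) - P (br x (br y z) + rhoR x (curvature P y z)).
  rewrite /varrhoL -[X in brg _ X]/(brg (P y) (P z) - P (br y z)).
  rewrite -[curvature P x (br y z)]/(brg (P x) (P (br y z)) - _).
  rewrite linearBr [P (_ + rhoR _ _)]raddfD opprD !addrA.
  by rewrite [LHS](ACl (1*2*4*5*3)) /= subrK.
have last : varrhoR brg rhoL P (curvature P u v) w + curvature P (br u v) w =
    brg (brg (P u) (P v)) (P w) - P (br (br u v) w + rhoL (curvature P u v) w).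
  rewrite /varrhoR -[X in brg X _]/(brg (P u) (P v) - P (br u v)).
  rewrite -[curvature P (br u v) w]/(brg (P (br u v)) (P w) - _).
  rewrite linearBl [P (_ + rhoL _ _)]raddfD opprD !addrA.
  by rewrite [LHS](ACl (1*2*4*5*3)) /= subrK.
rewrite (ACl ((1*6)*(2*5)*(3*4))) /= -!opprD step step last.
rewrite induced_bracket_defect leibniz_g -/br raddfD opprD addrACA.
by rewrite addrK subrr.
Qed.
End Bianchi.

(** * Polynomial curves in a vector space *)

Section PolynomialCurves.
Variable k : fieldType.

(** Generated by monomials under sums, so that stability under linear and
    bilinear maps is an induction with no bookkeeping of degrees. *)
Inductive polycurve (M : lmodType k) : (k -> M) -> Prop :=
| polycurve_mono n c : polycurve (fun s => s ^+ n *: c)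
| polycurve_add f1 f2 :
    polycurve f1 -> polycurve f2 -> polycurve (fun s => f1 s + f2 s)
| polycurve_eq f1 f2 : f1 =1 f2 -> polycurve f1 -> polycurve f2.

Lemma polycurve_const (M : lmodType k) (c : M) : polycurve (fun=> c).
Proof. by apply: polycurve_eq (polycurve_mono 0 c) => s; rewrite scale1r. Qed.

Lemma polycurve_linear (M M' : lmodType k) (A : {linear M -> M'}) (f : k -> M) :
  polycurve f -> polycurve (fun s => A (f s)).
Proof.
elim=> {f} [n c|f1 f2 _ IH1 _ IH2|f1 f2 eqf _ IHf].
- by apply: polycurve_eq (polycurve_mono n (A c)) => s; rewrite linearZ.
- by apply: polycurve_eq (polycurve_add IH1 IH2) => s /=; rewrite linearD.
- by apply: polycurve_eq IHf => s; rewrite eqf.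
Qed.

Lemma polycurve_scaleX (M : lmodType k) n (f : k -> M) :
  polycurve f -> polycurve (fun s => s ^+ n *: f s).
Proof.
elim=> {f} [m c|f1 f2 _ IH1 _ IH2|f1 f2 eqf _ IHf].
- apply: polycurve_eq (polycurve_mono (n + m) c) => s.
  by rewrite scalerA exprD.
- by apply: polycurve_eq (polycurve_add IH1 IH2) => s /=; rewrite scalerDr.
- by apply: polycurve_eq IHf => s; rewrite eqf.
Qed.

Lemma polycurve_bilinear (M1 M2 M : lmodType k)
    (B : {bilinear M1 -> M2 -> M}) (f1 : k -> M1) (f2 : k -> M2) :
  polycurve f1 -> polycurve f2 -> polycurve (fun s => B (f1 s) (f2 s)).
Proof.
move=> poly1 poly2; elim: poly1 => {f1} [n c|f f' _ IH1 _ IH2|f f' eqf _ IHf].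
- apply: polycurve_eq (polycurve_scaleX n (polycurve_linear (B c) poly2)) => s.
  by rewrite linearZl.
- by apply: polycurve_eq (polycurve_add IH1 IH2) => s /=; rewrite linearDl.
- by apply: polycurve_eq IHf => s; rewrite eqf.
Qed.

Lemma polycurve_opp (M : lmodType k) (f : k -> M) :
  polycurve f -> polycurve (fun s => - f s).
Proof. exact: (polycurve_linear (GRing.opp : {linear M -> M})). Qed.

Lemma polycurve_sum (M : lmodType k) (I : Type) (r : seq I) (p : pred I)
    (F : I -> k -> M) :
  (forall i, polycurve (F i)) -> polycurve (fun s => \sum_(i <- r | p i) F i s).
Proof.
move=> polyF; elim: r => [|i r IHr].
  by apply: polycurve_eq (polycurve_const 0) => s; rewrite big_nil.
have [pi|npi] := boolP (p i).
  apply: polycurve_eq (polycurve_add (polyF i) IHr) => s.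
  by rewrite big_cons pi.
by apply: polycurve_eq IHr => s; rewrite big_cons (negPf npi).
Qed.

(** The number of terms may be any large enough m, which lets the two summands
    of a sum share it. *)
Lemma polycurve_coef (M : lmodType k) (f : k -> M) :
  polycurve f ->
  exists (c : nat -> M) (n : nat), forall m, (n <= m)%N ->
    forall s, f s = \sum_(i < m) s ^+ i *: c i.
Proof.
elim=> {f} [n c|f1 f2 _ [c1 [n1 c1P]] _ [c2 [n2 c2P]]|f1 f2 eqf _ [c [n cP]]].
- exists (fun i => if i == n then c else 0), n.+1 => m lt_n_m s.
  rewrite (bigD1 (Ordinal lt_n_m)) //= eqxx big1 ?addr0 // => i /negPf.
  by rewrite -val_eqE /= => ->; rewrite scaler0.
- exists (fun i => c1 i + c2 i), (maxn n1 n2) => m.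
  rewrite geq_max => /andP[le1 le2] s.
  rewrite (c1P m) // (c2P m) // -big_split /=.
  by apply: eq_bigr => i _; rewrite scalerDr.
- by exists c, n => m le_n_m s; rewrite -eqf (cP m).
Qed.

Hypothesis char0 : [pchar k] =i pred0.

(** If f has degree at most n + 1, then f(2s) - 2^(n+1) f(s) has degree at most
    n and constant coefficient (1 - 2^(n+1)) f(0); in characteristic 0 the
    factor is invertible, whence the induction on n. *)
Lemma coef0_eq0 (M : lmodType k) n (c : nat -> M) :
  (forall s, s != 0 -> \sum_(i < n.+1) s ^+ i *: c i = 0) -> c 0%N = 0.
Proof.
have natr0 : forall m, (m%:R == 0 :> k) = (m == 0)%N by apply/pcharf0P.
elim: n c => [|n IHn] c c_eq0.
  by have := c_eq0 1 (oner_neq0 _); rewrite big_ord1 scale1r.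
have pow2_1 : 1 - 2%:R ^+ n.+1 != 0 :> k.
  rewrite subr_eq0 -natrX eq_sym -subr_eq0 -(natrB _ (expn_gt0 2 n.+1)) natr0.
  by rewrite subn_eq0 -ltnNge -[1%N](expn0 2) ltn_exp2l.
apply: (scalerI pow2_1); rewrite scaler0.
apply: (IHn (fun i => (2%:R ^+ i - 2%:R ^+ n.+1) *: c i)) => s s_neq0.
have two_s : 2%:R * s != 0 :> k by rewrite mulf_neq0 // natr0.
transitivity (\sum_(i < n.+2) (2%:R * s) ^+ i *: c i
              - 2%:R ^+ n.+1 *: \sum_(i < n.+2) s ^+ i *: c i); last first.
  by rewrite !c_eq0 // scaler0 subr0.
rewrite scaler_sumr -sumrB [RHS]big_ord_recr /= exprMn scalerA subrr addr0.
apply: eq_bigr => i _; rewrite !scalerA -scalerBl exprMn mulrBr.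
by rewrite ![s ^+ i * _]mulrC.
Qed.

Lemma polycurve_eq0 (M : lmodType k) (f : k -> M) :
  polycurve f -> (forall s, s != 0 -> f s = 0) -> f 0 = 0.
Proof.
move=> /polycurve_coef[c [n cP]] f_eq0; rewrite (cP n.+1) //.
rewrite big_ord_recl /= (@coef0_eq0 _ n c) ?scaler0 ?add0r => [|s s_neq0].
  by rewrite big1 // => i _; rewrite expr0n scale0r.
by rewrite -(cP n.+1) ?f_eq0.
Qed.
End PolynomialCurves.

(** * The curvature of a deformation evaluated at a scalar *)

Section Pencil.
Variables (k : fieldType) (lam : k) (g h : lmodType k).
Variables (brg : {bilinear g -> g -> g}) (brh : {bilinear h -> h -> h}).
Variables (rhoL : {bilinear g -> h -> h}) (rhoR : {bilinear h -> g -> h}).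
Variables (N : nat) (T_ : 'I_N.+1 -> {linear h -> g}).

Definition pencil (s : k) (u : h) : g := \sum_(i < N.+1) s ^+ i *: T_ i u.

Lemma pencil_is_linear s : linear (pencil s).
Proof.
move=> a u v; rewrite /pencil scaler_sumr -big_split /=.
apply: eq_bigr => i _; rewrite linearP scalerDr; congr (_ + _).
by rewrite !scalerA mulrC.
Qed.
HB.instance Definition _ s :=
  GRing.isLinear.Build k h g *:%R (pencil s) (pencil_is_linear s).

Lemma pencil0 : pencil 0 =1 T_ ord0.
Proof.
move=> u; rewrite /pencil big_ord_recl expr0 scale1r big1 ?addr0 // => i _.
by rewrite expr0n scale0r.
Qed.

(** The contribution of the pair (P, Q) to the curvature of a sum, apart from
    the term in lam. *)
Definition curvature_term (P Q : h -> g) (u v : h) : g :=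
  brg (P u) (Q v) - P (rhoL (Q u) v + rhoR u (Q v)).

Lemma curvature_term_is_bilinear (P Q : {linear h -> g}) :
  bilinear_for *:%R *:%R (curvature_term P Q).
Proof.
split=> [v a u1 u2|u a v1 v2]; rewrite /curvature_term.
  rewrite !linearP linearPl linearPl [rhoR (_ + _) _]linearPl addrACA -scalerDr.
  by rewrite linearP opprD addrACA -scalerBr.
rewrite !linearP addrACA -scalerDr.
by rewrite linearP opprD addrACA -scalerBr.
Qed.
HB.instance Definition _ (P Q : {linear h -> g}) :=
  bilinear_isBilinear.Build k h h g *:%R *:%R (curvature_term P Q)
    (curvature_term_is_bilinear P Q).

(** When the T_i form a deformation and s <> 0, the quotient by s^(N+1) of the
    curvature of [pencil s]; as a sum over the pairs of total degree above N it
    makes sense at s = 0 as well. *)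
Definition curvature_tail (s : k) (u v : h) : g :=
  \sum_(i < N.+1) \sum_(j < N.+1 | (N < i + j)%N)
     s ^+ (i + j - N.+1) *: curvature_term (T_ i) (T_ j) u v.

Lemma curvature_tail_is_bilinear s : bilinear_for *:%R *:%R (curvature_tail s).
Proof.
split=> [v a u1 u2|u a v1 v2];
  rewrite /= /curvature_tail scaler_sumr -big_split /=.
  apply: eq_bigr => i _; rewrite scaler_sumr -big_split /=.
  apply: eq_bigr => j _; rewrite linearPl scalerDr; congr (_ + _).
  by rewrite !scalerA mulrC.
apply: eq_bigr => i _; rewrite scaler_sumr -big_split /=.
apply: eq_bigr => j _; rewrite linearPr scalerDr; congr (_ + _).
by rewrite !scalerA mulrC.
Qed.
HB.instance Definition _ s :=
  bilinear_isBilinear.Build k h h g *:%R *:%R (curvature_tail s)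
    (curvature_tail_is_bilinear s).

(** A vector as a constant truncated power series. *)
Definition jet (W : zmodType) (w : W) : {ffun 'I_N.+1 -> W} :=
  [ffun i => if i == ord0 then w else 0].

Lemma trunc_map_jet u : trunc_map T_ (jet u) = [ffun l => T_ l u].
Proof.
apply/ffunP => l; rewrite !ffunE (bigD1 l) //= (bigD1 ord0) ?addn0 //=.
rewrite ffunE eqxx big1 => [|j /andP[_ /negPf jn0]]; last first.
  by rewrite ffunE jn0 linear0.
rewrite addr0 big1 ?addr0 // => i inl; rewrite big1 // => j /eqP ijl.
rewrite ffunE ifN ?linear0 //; apply: contraNneq inl => j0.
by rewrite -val_eqE /= -ijl j0 addn0.
Qed.

Lemma trunc_bilin_jetr (X Y W : lmodType k) (B : {bilinear X -> Y -> W}) x y :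
  trunc_bilin (N := N) B x (jet y) = [ffun l => B (x l) y].
Proof.
apply/ffunP => l; rewrite !ffunE (bigD1 l) //= (bigD1 ord0) ?addn0 //=.
rewrite ffunE eqxx big1 => [|j /andP[_ /negPf jn0]]; last first.
  by rewrite ffunE jn0 linear0r.
rewrite addr0 big1 ?addr0 // => i inl; rewrite big1 // => j /eqP ijl.
rewrite ffunE ifN ?linear0r //; apply: contraNneq inl => j0.
by rewrite -val_eqE /= -ijl j0 addn0.
Qed.

Lemma trunc_bilin_jetl (X Y W : lmodType k) (B : {bilinear X -> Y -> W}) x y :
  trunc_bilin (N := N) B (jet x) y = [ffun l => B x (y l)].
Proof.
apply/ffunP => l; rewrite !ffunE (bigD1 ord0) //= (bigD1 l) //=.
rewrite ffunE eqxx big1 => [|j /andP[/eqP jl /negP[]]]; last first.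
  by rewrite -val_eqE /= -jl.
rewrite addr0 big1 ?addr0 // => i /negPf in0; rewrite big1 // => j _.
by rewrite ffunE in0 linear0l.
Qed.

(** The coefficient of t^l in the Rota-Baxter equation of the deformation,
    evaluated at constant series: only T_l meets the bracket of h, since that
    bracket of constant series sits in degree 0. *)
Lemma deformation_coef (T : h -> g) (l : 'I_N.+1) u v :
  deformation lam brg brh rhoL rhoR T_ T ->
  \sum_(i < N.+1) \sum_(j < N.+1 | (i + j == l)%N)
    curvature_term (T_ i) (T_ j) u v = T_ l (lam *: brh u v).
Proof.
case=> _ /(_ (jet u) (jet v)) /ffunP /(_ l).
rewrite /induced_bracket !trunc_map_jet trunc_bilin_jetr !trunc_bilin_jetl.
rewrite !ffunE => eq_l.
have jet_l : \sum_(i < N.+1) \sum_(j < N.+1 | (i + j == l)%N)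
    T_ i (jet (lam *: brh u v) j) = T_ l (lam *: brh u v).
  by have /ffunP/(_ l) := trunc_map_jet (lam *: brh u v); rewrite !ffunE.
rewrite -jet_l; apply/eqP; rewrite -subr_eq0 -sumrB; apply/eqP.
transitivity (\sum_(i < N.+1) \sum_(j < N.+1 | (i + j == l)%N)
  brg (T_ i u) (T_ j v) - \sum_(i < N.+1) \sum_(j < N.+1 | (i + j == l)%N)
  T_ i (rhoL (T_ j u) v + rhoR u (T_ j v) + jet (lam *: brh u v) j)).
  rewrite -sumrB; apply: eq_bigr => i _; rewrite -!sumrB.
  by apply: eq_bigr => j _; rewrite [T_ i (_ + jet _ _)]linearD opprD addrA.
apply/eqP; rewrite subr_eq0; apply/eqP.
apply: (etrans _ (etrans eq_l _)); apply: eq_bigr => i _.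
  by apply: eq_bigr => j _; rewrite !ffunE.
apply: eq_bigr => j _; rewrite !ffunE; congr (T_ i (_ + _)).
by case: eqP => // _; rewrite linear0r scaler0.
Qed.

(** In the double sum over (i, j) of s^(i+j), the part with i + j <= N is, by
    [deformation_coef], the term in lam of the curvature, which cancels it. *)
Lemma curvature_pencil (T : h -> g) s u v :
  deformation lam brg brh rhoL rhoR T_ T ->
  curvature lam brg brh rhoL rhoR (pencil s) u v =
    s ^+ N.+1 *: curvature_tail s u v.
Proof.
move=> def_T; rewrite /curvature /induced_bracket.
have coef := deformation_coef _ u v def_T.
pose term (i j : 'I_N.+1) := s ^+ (i + j) *: curvature_term (T_ i) (T_ j) u v.
transitivity (\sum_(i < N.+1) \sum_(j < N.+1) term i j
              - pencil s (lam *: brh u v)).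
  rewrite [pencil s (_ + lam *: _)]linearD opprD addrA; congr (_ - _).
  rewrite /pencil linear_sumlz -sumrB; apply: eq_bigr => i _.
  rewrite linear_sumlz !linear_sumr -big_split linear_sum scaler_sumr -sumrB /=.
  apply: eq_bigr => j _.
  rewrite /term linearZl !linearZr [rhoL (_ *: _) _]linearZl /= -scalerDr.
  by rewrite [T_ i (_ *: _)]linearZ /= !scalerA -exprD -scalerBr.
have -> : pencil s (lam *: brh u v) =
    \sum_(i < N.+1) \sum_(j < N.+1 | (i + j < N.+1)%N) term i j.
  transitivity (\sum_(l < N.+1) \sum_(i < N.+1)
      \sum_(j < N.+1 | (i + j == l)%N) term i j).
    apply: eq_bigr => l _; rewrite -coef scaler_sumr; apply: eq_bigr => i _.
    by rewrite scaler_sumr; apply: eq_bigr => j /eqP ijl; rewrite /term ijl.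
  rewrite exchange_big; apply: eq_bigr => i _ /=.
  rewrite (exchange_big_dep (fun j : 'I_N.+1 => i + j < N.+1)%N) /=.
    apply: eq_bigr => j ltij; rewrite (bigD1 (Ordinal ltij)) //= big1 ?addr0 //.
    by move=> l /andP[/eqP ijl /negP[]]; rewrite -val_eqE /= ijl.
  by move=> l j _ /eqP->.
rewrite -sumrB /curvature_tail scaler_sumr; apply: eq_bigr => i _.
rewrite (bigID (fun j : 'I_N.+1 => i + j < N.+1)%N) /= addrC addrK scaler_sumr.
apply: eq_big => [j|j lt_N]; first by rewrite -leqNgt.
by rewrite /term scalerA -exprD subnKC // leqNgt.
Qed.

End Pencil.

(** * Balavoine's bracket in low arity *)

Section SmallArity.
Variables (k : fieldType) (V : lmodType k).

Definition binary (U W : Type) (F : U -> U -> W) : cochain 2 U W :=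
  fun x => F (x ord0) (x ord_max).

Lemma inord0 n : inord 0 = ord0 :> 'I_n.+1.
Proof. by apply: val_inj; rewrite /= inordK. Qed.

Lemma inord_max n : inord n = ord_max :> 'I_n.+1.
Proof. by apply: val_inj; rewrite /= inordK. Qed.

Lemma cast_inord m n (eq_mn : m.+1 = n.+1) a :
  (a <= m)%N -> cast_ord eq_mn (inord a) = inord a.
Proof.
by move=> le_a_m; apply: val_inj; rewrite /= !inordK // -eq_mn ltnS.
Qed.

Lemma permn1 n a : permn (1 : 'S_n) a = a.
Proof. by rewrite /permn; case: insubP => [a' _ <-|//]; rewrite perm1. Qed.

(** When i + n <= 1 the group of permutations of i + n elements is trivial, and
    the only shuffle is the identity. *)
Lemma circ_le1 (m n i : nat) (f : cochain m.+1 V V) (g : cochain n.+1 V V) x :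
  (i + n <= 1)%N ->
  circ i f g x =
    f [ffun a : 'I_m.+1 =>
        if (a < i)%N then x (inord a) else
        if a == i :> nat then g [ffun b : 'I_n.+1 => x (inord (i + b))]
        else x (inord (a + n))].
Proof.
move=> le1; have all1 (s : 'S_(i + n)) : s = 1%g.
  apply/permP => a; apply: val_inj => /=.
  have lt1 (b : 'I_(i + n)) : b = 0 :> nat.
    by apply/eqP; rewrite -leqn0 -ltnS (leq_trans (ltn_ord b)).
  by rewrite !lt1.
rewrite /circ (big_pred1 1%g) => [|s]; last first.
  rewrite [s]all1 /= eqxx !inE; apply/andP; split; apply/'forall_forallP => a b;
  by rewrite !perm1 /= ?ltn_add2l implybb.
rewrite odd_perm1 scale1r; congr f; apply/ffunP => a; rewrite !ffunE permn1.
case: ifP => // _; case: ifP => // _; congr g; apply/ffunP => b; rewrite !ffunE.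
rewrite permn1; case: ltnP => // le_n_b; congr (x (inord (_ + _))).
by apply/eqP; rewrite eqn_leq le_n_b -ltnS ltn_ord.
Qed.

Lemma big_S2 (F : 'S_2 -> V) :
  \sum_s F s = F 1%g + F (tperm ord0 ord_max).
Proof.
have I2 (a : 'I_2) : a = if a == ord0 then ord0 else ord_max.
  by apply: val_inj; case: a => -[|[]].
have s_max (s : 'S_2) : s ord_max = if s ord0 == ord0 then ord_max else ord0.
  have := inj_eq (@perm_inj _ s) ord_max ord0.
  by rewrite [s ord_max]I2 [s ord0]I2; do 2!case: (s _ == _).
rewrite (bigD1 1%g) //= (bigD1 (tperm ord0 ord_max)) /=; last first.
  by apply/eqP => /permP/(_ ord0); rewrite tpermL perm1.
rewrite big1 ?addr0 // => s /andP[/eqP s1 /eqP[]].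
apply/permP => a; rewrite [a]I2.
have s0 : s ord0 != ord0.
  apply: contra_notN s1 => /eqP s0; apply/permP => b; rewrite perm1 [b]I2.
  by case: ifP => _; rewrite // s_max s0.
case: ifP => _; first by rewrite tpermL [LHS]I2 (negPf s0).
by rewrite tpermR s_max (negPf s0).
Qed.

(** Every permutation of two elements is a (1, 1)-shuffle. *)
Lemma circ_1_1 (f g : cochain 2 V V) F G x :
  f =1 binary F -> g =1 binary G ->
  circ 1 f g x =
    F (x (inord 0)) (G (x (inord 1)) (x (inord 2)))
    - F (x (inord 1)) (G (x (inord 0)) (x (inord 2))).
Proof.
move=> fE gE; rewrite /circ (eq_bigl predT) => [|s]; last first.
  rewrite inE; apply/andP; split; apply/'forall_forallP => a b;
  by rewrite !ord1 ltnn.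
rewrite (big_S2 (fun s : 'S_(1 + 1) => _)) odd_perm1 odd_tperm scale1r scaleN1r.
rewrite !fE /binary !ffunE /= !gE /binary !ffunE /= !permn1.
have -> : permn (tperm ord0 ord_max : 'S_(1 + 1)) 0 = 1.
  rewrite /permn insubT /= [Sub _ _](_ : _ = ord0) ?tpermL //.
  exact: val_inj.
have -> // : permn (tperm ord0 ord_max : 'S_(1 + 1)) (1 + 0) = 0.
rewrite /permn insubT /= [Sub _ _](_ : _ = ord_max) ?tpermR //.
exact: val_inj.
Qed.

Lemma balavoine_2_1 (f : cochain 2 V V) (g : cochain 1 V V) F G :
  f =1 binary F -> g =1 cochain1 G ->
  balavoine f g =1
    binary (fun x y => F (G x) y + F x (G y) - G (F x y)).
Proof.
move=> fE gE x; rewrite /balavoine !big_ord_recl !big_ord0 /= !muln0 !mul0n.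
rewrite !expr0 !scale1r !addr0 !circ_le1 // !fE !gE /binary /cochain1 !ffunE /=.
by rewrite !cast_inord // -[ord0]inord0 -[ord_max]inord_max.
Qed.

Lemma balavoine_2_2 (f g : cochain 2 V V) F G x :
  f =1 binary F -> g =1 binary G ->
  balavoine f g x =
    let x0 := x (inord 0) in let x1 := x (inord 1) in let x2 := x (inord 2) in
    (F (G x0 x1) x2 - F x0 (G x1 x2) + F x1 (G x0 x2))
    + (G (F x0 x1) x2 - G x0 (F x1 x2) + G x1 (F x0 x2)).
Proof.
move=> fE gE; rewrite /balavoine !big_ord_recl !big_ord0 /= !muln1.
rewrite !expr0 !expr1 !scale1r !addr0 !scaleN1r opprK !(@circ_le1 1 1 0) //.
rewrite (circ_1_1 _ fE gE) (circ_1_1 _ gE fE) !fE !gE /binary !ffunE /=.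
have subBA (a b c : V) : a - (b - c) = a - b + c by rewrite opprD opprK addrA.
by rewrite !cast_inord // !subBA.
Qed.
End SmallArity.

(** * The differentials on 2-cochains *)

Section Unfolding.
Variables (k : fieldType) (lam : k) (g h : lmodType k).
Variables (brg : {bilinear g -> g -> g}) (brh : {bilinear h -> h -> h}).
Variables (rhoL : {bilinear g -> h -> h}) (rhoR : {bilinear h -> g -> h}).

(** The sum common to [delta_Leib] and [d_weight], for 2-cochains. *)
Lemma sum_contract2 (br : h -> h -> h) (f : cochain 2 h g) F u :
  f =1 binary F ->
  \sum_(i < 3) \sum_(j < 3 | (i < j)%N)
    (-1) ^+ i.+1 *: f (contract br i j u) =
  - F (br (u (inord 0)) (u (inord 1))) (u (inord 2))
  - F (u (inord 1)) (br (u (inord 0)) (u (inord 2)))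
  + F (u (inord 0)) (br (u (inord 1)) (u (inord 2))).
Proof.
(* Reading u through natural numbers lets the indices [lift i a] compute. *)
move=> fE; have [U uE] : exists U : nat -> h, forall i, u i = U i.
  by exists (fun a => u (inord a)) => i; rewrite inord_val.
under eq_bigr => i _ do rewrite big_mkcond.
rewrite !big_ord_recl !big_ord0 /= /contract /omit.
rewrite !fE /binary !ffunE /= !uE /= !inordK // /bump /=.
by rewrite expr1 sqrrN expr1n scale1r !scaleN1r !add0r !addr0.
Qed.

Lemma delta_Leib2 (T : {linear h -> g}) (f : cochain 2 h g) F u :
  f =1 binary F ->
  delta_Leib lam brg brh rhoL rhoR T f u =
    delta2 lam brg brh rhoL rhoR T F (u (inord 0)) (u (inord 1)) (u (inord 2)).
Proof.
move=> fE; rewrite /delta_Leib /delta2 (sum_contract2 _ _ fE) !addrA.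
congr (_ - _ - _ + _).
have [U uE] : exists U : nat -> h, forall i, u i = U i.
  by exists (fun a => u (inord a)) => i; rewrite inord_val.
rewrite !(big_mkcond (fun i => _ < _)%N) !big_ord_recl !big_ord0 /= /omit.
rewrite !fE /binary !ffunE /= !uE /= !inordK // /bump /=.
by rewrite expr0 expr1 scale1r -signr_odd !scaleN1r !addr0.
Qed.

(** Arguments (0, u) have no component in g, so every term of the iterated
    bracket that feeds one of them unchanged into a g-slot of theta vanishes. *)
Lemma derived_bracket11 (P Q : {linear h -> g}) u :
  derived_bracket brg rhoL rhoR (cochain1 P) (cochain1 Q) u =
  - (curvature_term brg rhoL rhoR P Q (u ord0) (u ord_max)
     + curvature_term brg rhoL rhoR Q P (u ord0) (u ord_max)).
Proof.
rewrite /derived_bracket /unembed.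
have thetaE : theta brg rhoL rhoR =1 binary (fun x y =>
  (brg x.1 y.1, rhoL x.1 y.2 + rhoR x.2 y.1)) by [].
have embedE (S : {linear h -> g}) :
    embed (cochain1 S) =1 cochain1 (fun x => (S x.2, 0)).
  by move=> x; rewrite /embed /cochain1 ffunE.
rewrite (balavoine_2_1 (balavoine_2_1 thetaE (embedE P)) (embedE Q)).
rewrite /binary !ffunE /=.
rewrite !(linear0, linear0l, linear0r, subr0, addr0, add0r, oppr0) scaleN1r.
congr (- _); rewrite /curvature_term !linearD /= !addrA.
by rewrite [LHS](ACl (3*2*4*1*5*6)).
Qed.

(** With lam = 0, since theta involves only the bracket of g and the actions;
    the rest of [delta_Leib] comes from [d_weight]. *)
Lemma derived_bracket12 (T : {linear h -> g}) (f : cochain 2 h g) F u :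
  f =1 binary F ->
  derived_bracket brg rhoL rhoR (cochain1 T) f u =
  delta2 0 brg brh rhoL rhoR T F (u (inord 0)) (u (inord 1)) (u (inord 2)).
Proof.
move=> fE.
rewrite /derived_bracket /unembed.
have thetaE : theta brg rhoL rhoR =1 binary (fun x y =>
  (brg x.1 y.1, rhoL x.1 y.2 + rhoR x.2 y.1)) by [].
have embedE1 : embed (cochain1 T) =1 cochain1 (fun x => (T x.2, 0)).
  by move=> x; rewrite /embed /cochain1 ffunE.
have embedE2 : embed f =1 binary (fun x y => (F x.2 y.2, 0)).
  by move=> x; rewrite /embed fE /binary !ffunE.
rewrite (balavoine_2_2 _ (balavoine_2_1 thetaE embedE1) embedE2).
rewrite /binary !ffunE /=.
rewrite !(linear0, linear0l, linear0r, subr0, addr0, add0r, oppr0) scaleN1r.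
rewrite /delta2 /varrhoL /varrhoR /induced_bracket !scale0r !addr0.
rewrite !opprD !opprK !addrA.
by rewrite [LHS](ACl (3*4*5*6*1*2*7*9*8)).
Qed.

(** Bilinearity of F splits F ({u, v}_T, w), and its analogues, into the part in
    [derived_bracket12] and the part in lam from [d_weight]. *)
Lemma d_T2 (T : {linear h -> g}) (f : cochain 2 h g)
    (F : {bilinear h -> h -> g}) u :
  f =1 binary F ->
  d_T lam brg brh rhoL rhoR T f u = delta_Leib lam brg brh rhoL rhoR T f u.
Proof.
move=> fE; rewrite /d_T (derived_bracket12 _ _ fE) (delta_Leib2 _ _ fE).
rewrite /d_weight (sum_contract2 _ _ fE) sqrrN expr1n scale1r.
rewrite /delta2 /induced_bracket !scale0r !addr0.
rewrite [F (_ + _ + lam *: _) _]linearDl ![F _ (_ + _ + lam *: _)]linearDr.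
move: (varrhoL _ _ _ (u (inord 0)) _) (varrhoL _ _ _ (u (inord 1)) _).
move: (varrhoR _ _ _ _ _) => R L0 L1.
by rewrite !opprD !addrA [LHS](ACl (4*5*6*7*1*8*2*9*3)).
Qed.

End Unfolding.

(** * The obstruction is a cocycle *)

Section Obstruction.
Variables (k : fieldType) (lam : k) (g h : lmodType k).
Variables (brg : {bilinear g -> g -> g}) (brh : {bilinear h -> h -> h}).
Variables (rhoL : {bilinear g -> h -> h}) (rhoR : {bilinear h -> g -> h}).
Variables (N : nat) (T_ : 'I_N.+1 -> {linear h -> g}).
Hypothesis char0 : [pchar k] =i pred0.

Local Notation pencil := (pencil T_).
Local Notation tail := (curvature_tail brg rhoL rhoR T_).

(** At s = 0 the factor s^(i+j-N-1) keeps exactly the pairs with i + j = N + 1;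
    the bounds 0 < i and 0 < j then follow from i, j <= N.  The derived bracket
    of T_i and T_j is minus the sum of the contributions of (i, j) and (j, i),
    so that halving its sum gives the sum over ordered pairs. *)
Lemma obstructionE :
  obstruction brg rhoL rhoR T_ =1 binary (tail 0).
Proof.
move=> u; rewrite /obstruction /binary.
pose term i j :=
  curvature_term brg rhoL rhoR (T_ i) (T_ j) (u ord0) (u ord_max).
pose total := \sum_(i < N.+1) \sum_(j < N.+1 | (i + j == N.+1)%N) term i j.
have -> : tail 0 (u ord0) (u ord_max) = total.
  apply: eq_bigr => i _; rewrite big_mkcond [RHS]big_mkcond.
  apply: eq_bigr => j _; have [lt_N|//|eq_N] := ltngtP N.+1 (i + j)%N.
    by rewrite expr0n subn_eq0 leqNgt lt_N scale0r.
  by rewrite -eq_N subnn scale1r.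
transitivity (2%:R^-1 *: (total + total)); last first.
  rewrite -mulr2n -scaler_nat scalerA mulVf ?scale1r //.
  by move/pcharf0P: char0 => ->.
rewrite scaleNr -scalerN; congr (_ *: _).
have {2}-> : total =
    \sum_(i < N.+1) \sum_(j < N.+1 | (i + j == N.+1)%N) term j i.
  rewrite /total (exchange_big_dep predT) //=.
  by apply: eq_bigr => i _; apply: eq_bigl => j; rewrite addnC.
rewrite -sumrN -big_split; apply: eq_bigr => i _ /=.
rewrite -sumrN -big_split; apply: eq_big => [j|j _] /=; last first.
  by rewrite derived_bracket11 opprK.
have [eq_N|//] := eqVneq (i + j)%N N.+1.
move: (nat_of_ord i) (nat_of_ord j) eq_N (ltn_ord i) (ltn_ord j) => a b <-.
rewrite -{1}[a]addn0 ltn_add2l => b_gt0.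
by rewrite -{1}[b]add0n ltn_add2r b_gt0 => ->.
Qed.

Lemma polycurve_pencil (x : k -> h) :
  polycurve x -> polycurve (fun s => pencil s (x s)).
Proof.
move=> poly_x; apply: polycurve_sum => i; apply: polycurve_scaleX.
exact: polycurve_linear.
Qed.

Lemma polycurve_tail (x y : k -> h) :
  polycurve x -> polycurve y -> polycurve (fun s => tail s (x s) (y s)).
Proof.
move=> poly_x poly_y; apply: polycurve_sum => i; apply: polycurve_sum => j.
by apply: polycurve_scaleX; apply: polycurve_bilinear.
Qed.

Lemma polycurve_induced_bracket (x y : k -> h) :
  polycurve x -> polycurve y ->
  polycurve (fun s => induced_bracket lam brh rhoL rhoR (pencil s) (x s) (y s)).
Proof.
move=> poly_x poly_y; apply: polycurve_add; last first.
  apply: (polycurve_linear ( *:%R lam : {linear h -> h})).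
  exact: polycurve_bilinear.
by apply: polycurve_add; apply: polycurve_bilinear => //;
  apply: polycurve_pencil.
Qed.

Lemma polycurve_delta2_tail u v w :
  polycurve (fun s => delta2 lam brg brh rhoL rhoR (pencil s) (tail s) u v w).
Proof.
have cst (z : h) := polycurve_const z.
rewrite /delta2 /varrhoL /varrhoR.
by do ![apply: polycurve_add | apply: polycurve_opp | apply: polycurve_bilinear
  | apply: polycurve_pencil | apply: polycurve_tail
  | apply: polycurve_induced_bracket].
Qed.

Lemma delta2_scale (P : {linear h -> g}) (F F' : h -> h -> g) c u v w :
  (forall x y, F' x y = c *: F x y) ->
  delta2 lam brg brh rhoL rhoR P F' u v w =
    c *: delta2 lam brg brh rhoL rhoR P F u v w.
Proof.
move=> F'E; rewrite /delta2 /varrhoL /varrhoR !F'E.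
rewrite !linearZr !linearZl /= ![P (_ *: _)]linearZ /=.
by rewrite !(scalerDr, scalerN).
Qed.

Hypotheses (leibniz_g : leibniz_bracket brg) (leibniz_h : leibniz_bracket brh).
Hypothesis rep_h : leibniz_representation brg brh rhoL rhoR.

(** The Bianchi identity of [pencil s], divided by s^(N+1) for s <> 0 and then
    extended to s = 0. *)
Lemma delta2_tail0 (T : {linear h -> g}) u v w :
  deformation lam brg brh rhoL rhoR T_ T ->
  delta2 lam brg brh rhoL rhoR T (tail 0) u v w = 0.
Proof.
move=> def_T.
have T0 x : T x = pencil 0 x by rewrite pencil0; case: def_T.
transitivity (delta2 lam brg brh rhoL rhoR (pencil 0) (tail 0) u v w).
  by rewrite /delta2 /varrhoL /varrhoR /induced_bracket !T0.
apply: (polycurve_eq0 char0 (polycurve_delta2_tail u v w)) => s s_neq0.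
apply: (scalerI (expf_neq0 N.+1 s_neq0)); rewrite scaler0.
rewrite -(delta2_scale (pencil s) u v w
           (fun x y => curvature_pencil s x y def_T)).
exact: delta2_curvature.
Qed.

Lemma multilinear_binary (F : {bilinear h -> h -> g}) :
  multilinear (binary F : cochain 2 h g).
Proof.
move=> i x a u v; rewrite /binary /update !ffunE.
have [->|/negPf i0] := eqVneq i ord0; first by rewrite /= linearPl.
have -> : i = ord_max by case: i i0 => -[|[]] //= lti _; apply: val_inj.
by rewrite /= linearPr.
Qed.

End Obstruction.

Theorem proposition5p9 (k : fieldType) (char0 : [pchar k] =i pred0) (lam : k)
    (g h : lmodType k)
    (brg : {bilinear g -> g -> g}) (brh : {bilinear h -> h -> h})
    (leibniz_g : leibniz_bracket brg) (leibniz_h : leibniz_bracket brh)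
    (rhoL : {bilinear g -> h -> h}) (rhoR : {bilinear h -> g -> h})
    (rep_h : leibniz_representation brg brh rhoL rhoR)
    (T : {linear h -> g})
    (rb_T : relative_rota_baxter lam brg brh rhoL rhoR T)
    (N : nat) (T_ : 'I_N.+1 -> {linear h -> g})
    (def_T : deformation lam brg brh rhoL rhoR T_ T) :
  let Ob := obstruction brg rhoL rhoR T_ in
  [/\ multilinear Ob,
      forall u, delta_Leib lam brg brh rhoL rhoR T Ob u = 0
    & forall u, d_T lam brg brh rhoL rhoR T Ob u = 0].
Proof.
move=> Ob.
have ObE : Ob =1 binary (curvature_tail brg rhoL rhoR T_ 0).
  exact: obstructionE.
have delta0 u : delta_Leib lam brg brh rhoL rhoR T Ob u = 0.
  by rewrite (delta_Leib2 _ _ _ _ _ _ _ ObE); apply: delta2_tail0.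
split=> // [i x a u v|u]; first by rewrite !ObE; apply: multilinear_binary.
by rewrite (d_T2 _ _ _ _ _ _ _ ObE).
Qed.
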